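(* Let $(\Omega,\mathcal{F})$ be a measurable space, $T:\Omega\to\Omega$ a measurable transformation and $V$ a $T$-invariant upper probability. Then $V$ is ergodic with respect to $T$ if and only if there exists a unique $Q\in\mathcal{M}^e(T)\cap\operatorname{core}(V)$ such that for every $f\in L^1(\Omega,\mathcal{F},Q)$, $$\lim_{n\to\infty}\frac{1}{n}\sum_{i=0}^{n-1}f(T^i\omega)=\int f\,dQ\quad\text{for }V\text{-a.s. }\omega\in\Omega.$$
   Context: A capacity is a monotone map $\mu:\mathcal{F}\to[0,1]$ with $\mu(\emptyset)=0,\mu(\Omega)=1$. An upper probability is a capacity $V$ such that $V(A)=\max_{P\in\Lambda}P(A)$ for a set $\Lambda$ of probabilities compact in the weak* (setwise convergence) topology. $V$ is $T$-invariant if $V(T^{-1}A)=V(A)$ for all $A\in\mathcal{F}$. $\mathcal{I}=\{A\in\mathcal{F}:T^{-1}A=A\}$. A $T$-invariant capacity $\mu$ is ergodic if for each $B\in\mathcal{I}$, $\mu(B)\in\{0,1\}$ and ($\mu(B)=0$ or $\mu(\Omega\setminus B)=0$). $\operatorname{core}(V)$ is the set of finitely additive normalized $P:\mathcal{F}\to[0,1]$ with $P\le V$ on $\mathcal{F}$. $\mathcal{M}^e(T)$ is the set of $T$-invariant probabilities $P$ with $P(A)\in\{0,1\}$ for all $A\in\mathcal{I}$. A statement holds $V$-a.s. if it holds on a set $A\in\mathcal{F}$ with $V(\Omega\setminus A)=0$. *)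

(* Defs.v *)
From HB Require Import structures.
From mathcomp Require Import all_boot all_order all_algebra.
From mathcomp Require Import all_classical all_reals all_analysis.
Set Implicit Arguments. Unset Strict Implicit. Unset Printing Implicit Defensive.
Import Order.TTheory GRing.Theory Num.Theory numFieldNormedType.Exports.
Local Open Scope classical_set_scope.
Local Open Scope ring_scope.

Section defs.
Context (d : measure_display) (T : measurableType d) (R : realType).

Definition mset := {A : set T | measurable A}.

(* a probability seen as a point of [0,1]^F, i.e. of R^F with the product
   (pointwise) topology: the setwise-convergence (weak* ) topology on
   probabilities is the initial topology of this map *)
Definition setwise_eval (P : probability T R) : @prod_topology mset (fun _ : mset => R) :=
  fun A => fine (P (proj1_sig A)).

Definition setwise_compact (L : set (probability T R)) : Prop :=
  compact (setwise_eval @` L).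

Definition capacity (mu : set T -> R) : Prop :=
  [/\ forall A B, measurable A -> measurable B -> A `<=` B -> mu A <= mu B,
      mu set0 = 0 & mu setT = 1].

Definition upper_probability (V : set T -> R) : Prop :=
  capacity V /\
  exists L : set (probability T R), setwise_compact L /\
    forall A, measurable A ->
      (exists2 P, L P & fine (P A) = V A) /\
      (forall P, L P -> fine (P A) <= V A).

Definition invariant_set (tr : T -> T) (A : set T) : Prop :=
  measurable A /\ tr @^-1` A = A.

Definition cap_invariant (tr : T -> T) (mu : set T -> R) : Prop :=
  forall A, measurable A -> mu (tr @^-1` A) = mu A.

Definition cap_ergodic (tr : T -> T) (mu : set T -> R) : Prop :=
  cap_invariant tr mu /\
  forall B, invariant_set tr B ->
    (mu B = 0 \/ mu B = 1) /\ (mu B = 0 \/ mu (~` B) = 0).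

(* P in core(V) : P <= V on F (P a probability, hence finitely additive and
   normalized) *)
Definition in_core (V : set T -> R) (P : probability T R) : Prop :=
  forall A, measurable A -> fine (P A) <= V A.

Definition ergodic_prob (tr : T -> T) (P : probability T R) : Prop :=
  (forall A, measurable A -> P (tr @^-1` A) = P A) /\
  forall A, invariant_set tr A -> P A = 0%E \/ P A = 1%E.

Definition cap_as (V : set T -> R) (p : T -> Prop) : Prop :=
  exists A, [/\ measurable A, V (~` A) = 0 & forall w, A w -> p w].

Definition birkhoff_avg (tr : T -> T) (f : T -> R) (w : T) (n : nat) : R :=
  n%:R^-1 * \sum_(i < n) f (iter i tr w).

Definition limit_property (tr : T -> T) (V : set T -> R) (Q : probability T R) :=
  forall f : T -> R, Q.-integrable setT (EFin \o f) ->
    cap_as V (fun w => birkhoff_avg tr f w @ \oo --> fine (\int[Q]_x (f x)%:E)).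

End defs.

(* Main.v *)
Require Import Defs.
From HB Require Import structures.
From mathcomp Require Import all_boot all_order all_algebra.
From mathcomp Require Import all_classical all_reals all_analysis.
From mathcomp Require Import measurable_realfun lra.
Set Implicit Arguments. Unset Strict Implicit. Unset Printing Implicit Defensive.
Import Order.TTheory GRing.Theory Num.Theory Num.Def numFieldNormedType.Exports.
Local Open Scope classical_set_scope.
Local Open Scope ring_scope.

(* Averaging the images of an element of the generating set under the powers
   of [tr] gives, along an ultrafilter, an invariant finitely additive [Q <= V];
   compactness makes [V] continuous at the empty set, so [Q] is a probability,
   and ergodicity of [V] passes to [Q].  For the limit, the points where the
   Birkhoff sums of [g := f - \int f dQ - e] are unbounded above form an
   invariant set, so either it or its complement is [V]-null; the latter is impossible
   since unboundedness [Q]-almost everywhere would force [0 <= \int g dQ = - e].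
   Hence, applying this to [f] and [- f], the averages converge [V]-a.s.
   Conversely the limit for the indicator of an invariant set [B] says that
   [B] or its complement is [V]-null, and the limits for indicators determine
   [Q]. *)

(** * Birkhoff sums, their running maxima and their unboundedness *)

Section birkhoff_sums.
Context (d : measure_display) (T : measurableType d) (R : realType).
Context (tr : T -> T) (mtr : measurable_fun setT tr).
Implicit Types (f g : T -> R) (w : T).

Definition birkhoff_sum g w n : R := \sum_(i < n) g (iter i tr w).

Lemma birkhoff_sumS g w n :
  birkhoff_sum g w n.+1 = g w + birkhoff_sum g (tr w) n.
Proof.
rewrite /birkhoff_sum big_ord_recl; congr (_ + _).
by apply: eq_bigr => i _; rewrite -iterSr.
Qed.

Lemma measurable_iter n : measurable_fun setT (iter n tr).
Proof.
elim: n => [|n ih]; first exact: measurable_id.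
exact: (measurableT_comp mtr ih).
Qed.

Lemma measurable_birkhoff_sum g n : measurable_fun setT g ->
  measurable_fun setT (fun w => birkhoff_sum g w n).
Proof.
move=> mg; apply: measurable_sum => i.
exact: (measurableT_comp mg (measurable_iter i)).
Qed.

Definition unbounded_sums g : set T :=
  [set w | forall K : R, exists n, K < birkhoff_sum g w n].

(** Moving the starting point from [w] to [tr w] changes the sums only by the fixed real [g w],
    which cannot affect unboundedness. *)
Lemma unbounded_sums_invariant g : measurable_fun setT g ->
  invariant_set tr (unbounded_sums g).
Proof.
move=> mg; split.
  have -> : unbounded_sums g = \bigcap_(K : nat) \bigcup_n
      [set w | K%:R < birkhoff_sum g w n].
    apply/seteqP; split=> [w ug K _|w ug K].
      by have [n nK] := ug K%:R; exists n.
    have [n _] := ug (Num.bound `|K|) I; exists n.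
    by rewrite (le_lt_trans (ler_norm _))// (lt_trans (archi_boundP _)).
  apply: bigcap_measurable => // K _; apply: bigcup_measurable => n _.
  rewrite -[X in measurable X]setTI.
  have mK : measurable_fun setT (cst K%:R : T -> R) by [].
  exact: (measurable_fun_ltr mK (measurable_birkhoff_sum n mg)
    measurableT (Y := [set true])).
apply/seteqP; split=> w uw K.
  have [n Kn] := uw (K - g w); exists n.+1.
  by rewrite birkhoff_sumS -ltrBlDl.
(* Taking the maximum with 0 rules out the empty sum, so the first term [g w] can be split off. *)
have [[|n] Kn] := uw (maxr 0 (K + g w)).
  by move: Kn; rewrite /birkhoff_sum big_ord0 gt_max ltxx.
exists n; move: Kn; rewrite birkhoff_sumS gt_max => /andP[_].
by rewrite addrC ltrD2l.
Qed.

(** This is the maximum of the sums [birkhoff_sum g w k] over [k <= n], the empty sum included. The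
    recursion through [tr w] makes the comparison of [birkhoff_max g n.+1] with
    [birkhoff_max g n \o tr] hold by computation. *)
Fixpoint birkhoff_max g n : T -> R :=
  if n is m.+1 then fun w => maxr 0 (g w + birkhoff_max g m (tr w))
  else cst 0.

Lemma birkhoff_max_ge0 g n w : 0 <= birkhoff_max g n w.
Proof. by case: n => //= n; rewrite le_max lexx. Qed.

Lemma birkhoff_max_leS g n w : birkhoff_max g n w <= birkhoff_max g n.+1 w.
Proof.
elim: n w => [|n ih] w; first exact: birkhoff_max_ge0.
have := ih (tr w); rewrite /= => ih'.
by rewrite ge_max !le_max lexx /= lerD2l ih' orbT.
Qed.

Lemma birkhoff_max_nondecreasing g w :
  nondecreasing_seq (fun n => birkhoff_max g n w).
Proof. by apply/nondecreasing_seqP => n; exact: birkhoff_max_leS. Qed.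

Lemma birkhoff_sum_le_max g n w : birkhoff_sum g w n <= birkhoff_max g n w.
Proof.
elim: n w => [|n ih] w; first by rewrite /birkhoff_sum big_ord0.
by rewrite birkhoff_sumS /= le_max lerD2l ih orbT.
Qed.

Lemma measurable_birkhoff_max g n : measurable_fun setT g ->
  measurable_fun setT (birkhoff_max g n).
Proof.
move=> mg; elim: n => [|n ih] /=; first exact: measurable_cst.
apply: measurable_maxr => //; apply: measurable_funD => //.
exact: measurableT_comp.
Qed.

(** * Integration of Birkhoff sums against an invariant measure *)

Section invariant_measure.
Local Open Scope ereal_scope.
Context (mu : {measure set T -> \bar R}).
Hypothesis mu_tr : forall A, measurable A -> mu (tr @^-1` A) = mu A.

Lemma ge0_integral_comp_tr (f : T -> \bar R) : measurable_fun setT f ->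
  (forall x, 0 <= f x) -> \int[mu]_x f (tr x) = \int[mu]_x f x.
Proof.
move=> mf f0; have := @ge0_integral_pushforward _ _ _ _ _ tr mtr mu setT f
  measurableT mf (fun y _ => f0 y).
rewrite preimage_setT => <-.
apply: (@eq_measure_integral _ _ _ setT mu (pushforward mu tr)).
by move=> A mA _; exact: mu_tr.
Qed.

Lemma integrable_comp_tr f : mu.-integrable setT (EFin \o f) ->
  mu.-integrable setT (EFin \o (f \o tr)).
Proof.
move=> /integrableP[mf foo]; apply/integrableP; split.
  exact: (measurableT_comp mf mtr).
by rewrite (@ge0_integral_comp_tr (fun x => `|(f x)%:E|)) //;
  exact: measurableT_comp.
Qed.

Lemma integrable_birkhoff_max g n : mu.-integrable setT (EFin \o g) ->
  mu.-integrable setT (EFin \o birkhoff_max g n).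
Proof.
move=> ig; have mg : measurable_fun setT g.
  by move/integrableP : ig => [/measurable_EFinP].
elim: n => [|n ih]; first exact: integrable0.
have := integrableD measurableT ig (integrable_comp_tr ih).
apply: le_integrable => //.
  by apply/measurable_EFinP; exact: measurable_birkhoff_max.
move=> x _ /=; rewrite lee_fin ger0_norm ?le_max ?lexx//.
by rewrite ge_max normr_ge0 ler_norm.
Qed.

(* [birkhoff_max g n.+1 - birkhoff_max g n \o tr] is the truncation
   [max g (- birkhoff_max g n \o tr)]: its integral is nonnegative by
   invariance of [mu], and it tends to [g] wherever the sums are unbounded. *)
Lemma integral_ge0_unbounded_sums g : mu.-integrable setT (EFin \o g) ->
  mu (~` unbounded_sums g) = 0 -> 0 <= \int[mu]_x (g x)%:E.
Proof.
move=> ig mu0; have mg : measurable_fun setT g.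
  by move/integrableP : ig => [/measurable_EFinP].
have [mu_g inv_g] := unbounded_sums_invariant mg.
pose h n w := maxr (g w) (- birkhoff_max g n (tr w))%R.
have hE n w : h n w = (birkhoff_max g n.+1 w - birkhoff_max g n (tr w))%R.
  by rewrite /h /= addr_maxl sub0r addrK maxC.
have mh n : measurable_fun setT (h n).
  apply: measurable_maxr => //; apply: measurable_funN.
  apply: (measurableT_comp _ mtr); exact: measurable_birkhoff_max.
have [_ _] : [/\ mu.-integrable setT (EFin \o g), 
    [sequence \int[mu]_x `|(h n x)%:E - (g x)%:E|]_n @ \oo --> 0%E &
    [sequence \int[mu]_x (h n x)%:E]_n @ \oo --> \int[mu]_x (g x)%:E].
  apply: (@dominated_convergence _ _ _ mu setT measurableT
    (fun n x => (h n x)%:E) (EFin \o g) (EFin \o (normr \o g))).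
  - by move=> n; exact/measurable_EFinP.
  - exact/measurable_EFinP.
  - exists (~` unbounded_sums g); split => //; first exact: measurableC.
    (* By invariance the sums from [tr w] are unbounded too. Once their maximum exceeds [- g w], the
       truncation is inactive and [h n w = g w]. *)
    apply: subsetC => w ug _; apply: cvg_near_cst.
    move: ug; rewrite -inv_g => /(_ (- g w)%R)[n gn].
    exists n => // m /= nm; congr EFin; apply/max_idPl.
    rewrite lerNl (le_trans (ltW gn))// (le_trans (birkhoff_sum_le_max _ _ _))//.
    exact: birkhoff_max_nondecreasing.
  - exact: integrable_norm.
  (* [normr \o g] dominates: where the truncation is active, [g x <= h n x <= 0]. *)
  - apply: aeW => x n _ /=; rewrite lee_fin /h.
    have := birkhoff_max_ge0 g n (tr x) => M0.
    case: (leP (g x) (- birkhoff_max g n (tr x))%R) => // gM.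
    have g0 : (g x <= 0)%R by rewrite (le_trans gM)// oppr_le0.
    by rewrite normrN (ler0_norm g0) ger0_norm// lerNr.
move=> hg; rewrite -(cvg_lim _ hg)//; apply: lime_ge.
  by apply/cvg_ex; eexists; exact: hg.
apply: nearW => n /=.
under eq_integral do rewrite hE EFinB.
rewrite integralB_EFin//; last 2 first.
- exact: integrable_birkhoff_max.
- exact/integrable_comp_tr/integrable_birkhoff_max.
rewrite (@ge0_integral_comp_tr (EFin \o birkhoff_max g n)); last 2 first.
- by apply/measurable_EFinP; exact: measurable_birkhoff_max.
- by move=> x; rewrite lee_fin birkhoff_max_ge0.
rewrite sube_ge0; last first.
  by apply/orP; left; exact/integrable_fin_num/integrable_birkhoff_max.
apply: ge0_le_integral => //.
- by move=> x _; rewrite lee_fin birkhoff_max_ge0.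
- by apply/measurable_EFinP; exact: measurable_birkhoff_max.
- by apply/measurable_EFinP; exact: measurable_birkhoff_max.
- by move=> x _; rewrite lee_fin birkhoff_max_leS.
Qed.

End invariant_measure.
End birkhoff_sums.

(** Compactness of the segment gives a cluster point. An ultrafilter contains the preimage of each
    of its neighbourhoods or the complement of that preimage, and clustering excludes the latter. *)
Lemma ultra_bounded_cvg (R : realType) (I : Type) (U : set_system I)
    (UU : UltraFilter U) (u : I -> R) (a b : R) :
  (forall i, a <= u i <= b) -> cvg (u @ U).
Proof.
move=> uab; have PU : ProperFilter U by exact: ultra_proper.
have Uab : (u @ U) [set` `[a, b]].
  by apply: (@filterE _ U) => i; rewrite /= in_itv; exact: uab.
have [p [_ clp]] := segment_compact (fmap_proper_filter u PU) Uab.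
apply/cvg_ex; exists p => N pN.
have [//|UN] := in_ultra_setVsetC (u @^-1` N) UU.
have [x [nNx Nx]] : (~` N) `&` N !=set0 by exact: clp.
by have := nNx Nx.
Qed.

(** * Continuity properties of upper probabilities *)

Section upper_probability.
Context (d : measure_display) (T : measurableType d) (R : realType).
Context (V : set T -> R) (upV : upper_probability V).

Lemma upper_probability_le A B :
  measurable A -> measurable B -> A `<=` B -> V A <= V B.
Proof. by case: upV => -[leV _ _] _; exact: leV. Qed.

Lemma upper_probability_set0 : V set0 = 0.
Proof. by case: upV => -[]. Qed.

Lemma upper_probability_setT : V setT = 1.
Proof. by case: upV => -[]. Qed.

Lemma upper_probability_ge0 A : measurable A -> 0 <= V A.
Proof.
by move=> mA; rewrite -upper_probability_set0; exact: upper_probability_le.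
Qed.

(* Compactness upgrades the continuity at [set0] of each element of the
   generating set to a uniform one. *)
Lemma upper_probability_cvg0 (F : nat -> set T) (e : R) :
  (forall n, measurable (F n)) -> (forall n m, (n <= m)%N -> F m `<=` F n) ->
  \bigcap_n F n = set0 -> 0 < e -> exists n, V (F n) < e.
Proof.
move=> mF ndF F0 e0; apply: contrapT => /forallNP Fe.
have {}Fe n : e <= V (F n) by rewrite leNgt; apply/negP/Fe.
have [_ [L [cL LV]]] := upV.
have /choice[P_ P_F] n : exists P, L P /\ fine (P (F n)) = V (F n).
  by have [[P LP PF] _] := LV _ (mF n); exists P.
have [phi [[P LP <-{phi}] clP]] : (@setwise_eval d T R @` L) `&`
    cluster ((fun n => setwise_eval (P_ n)) @ \oo) !=set0.
  apply: cL; apply: (@filterE _ \oo) => n /=.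
  by exists (P_ n) => //; case: (P_F n).
(* For [n >= m], [P_ n (F m) >= P_ n (F n) = V (F n) >= e]. Evaluation at [F m] is continuous in the
   product topology, so the cluster point [P] inherits the bound up to a loss of [e / 2]. This
   contradicts the continuity of [P] at [set0]. *)
have Pe m : e / 2 <= fine (P (F m)).
  pose Fm : Defs.mset T := exist _ (F m) (mF m).
  have [phi [/= phi1 phi2]] : [set phi : @prod_topology (Defs.mset T) (fun=> R) |
      e <= phi Fm] `&` [set phi | `|setwise_eval P Fm - phi Fm| < e / 2] !=set0.
    apply: clP.
      exists m => // n /= mn; have [_ PF] := P_F n.
      rewrite (le_trans (Fe n))// -PF /setwise_eval/=.
      apply: fine_le; rewrite ?fin_num_measure//.
      by apply: le_measure; rewrite ?inE//; exact: ndF.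
    have nP : nbhs (setwise_eval P Fm : R)
        [set y | `|setwise_eval P Fm - y| < e / 2].
      by apply/nbhs_ballP; exists (e / 2) => //=; rewrite divr_gt0.
    exact: (@proj_continuous {classic Defs.mset T} (fun=> R) Fm
      (setwise_eval P) _ nP).
  rewrite -[fine _]/(setwise_eval P Fm).
  by move: phi2; rewrite ltr_distlC => /andP[_]; lra.
have : (P \o F) n @[n --> \oo] --> P (\bigcap_n F n).
  apply: nonincreasing_cvg_mu => //.
  - by rewrite (le_lt_trans (probability_le1 _ _))// ltey.
  - by rewrite F0.
  - by move=> n m nm; exact/subsetPset/ndF.
rewrite F0 measure0 => /fine_cvgP[_ /cvgr_dist_lt /(_ (e / 2))].
have e20 : 0 < e / 2 by lra.
move=> /(_ e20)[n _ /(_ n (leqnn _))] /=.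
by rewrite sub0r normrN ltNge (le_trans (Pe n)) ?ler_norm.
Qed.

(** The value at the union is attained by a single [P] of the generating set, and each [F n] is
    [P]-null because [P <= V]. *)
Lemma upper_probability_bigcup0 (F : nat -> set T) :
  (forall n, measurable (F n)) -> (forall n, V (F n) = 0) ->
  V (\bigcup_n F n) = 0.
Proof.
move=> mF F0; have [_ [L [_ LV]]] := upV.
have mUF : measurable (\bigcup_n F n) by apply: bigcup_measurable.
have [[P LP <-] _] := LV _ mUF.
suff /(negligibleP P mUF) -> : P.-negligible (\bigcup_n F n) by [].
apply: negligible_bigcup => n; apply/negligibleP => //.
apply/eqP; rewrite eq_le measure_ge0 andbT.
have [_ /(_ P LP)] := LV _ (mF n).
by rewrite F0 -lee_fin fineK ?fin_num_measure.
Qed.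

(** * Finitely additive set functions below an upper probability *)

Section dominated_content.
Context (q : set T -> R).
Hypothesis q_ge0 : forall A, measurable A -> 0 <= q A.
Hypothesis q_setT : q setT = 1.
Hypothesis qU : forall A B, measurable A -> measurable B -> A `&` B = set0 ->
  q (A `|` B) = q A + q B.
Hypothesis q_le : forall A, measurable A -> q A <= V A.

(** By finite additivity the error of the partial sum is [q] of the tail union. It is at most [V] of
    that tail, and the tails decrease to [set0]. *)
Lemma dominated_content_sigma_additive (F : nat -> set T) :
  (forall n, measurable (F n)) -> trivIset setT F ->
  \sum_(0 <= i < n) q (F i) @[n --> \oo] --> q (\bigcup_n F n).
Proof.
move=> mF tF; pose U n := \bigcup_(i in [set i | (n <= i)%N]) F i.
have mU n : measurable (U n) by apply: bigcup_measurable.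
have US n : U n = F n `|` U n.+1.
  apply/seteqP; split=> [w [i /= ni Fi]|w [Fn|[i /= ni Fi]]].
  - move: ni; rewrite leq_eqVlt => /orP[/eqP ->|ni]; first by left.
    by right; exists i.
  - by exists n => /=.
  - by exists i => //=; exact: ltnW.
have FU n : F n `&` U n.+1 = set0.
  rewrite -subset0 => w [Fn [i /= ni Fi]].
  have := tF n i I I (ex_intro _ w (conj Fn Fi)).
  by move=> ein; rewrite ein ltnn in ni.
have U0 : \bigcup_n F n = U 0%N by apply: eq_bigcupl; split.
have qU0 n : \sum_(0 <= i < n) q (F i) = q (U 0%N) - q (U n).
  elim: n => [|n ih]; first by rewrite big_geq// subrr.
  by rewrite big_nat_recr//= ih [in X in _ - X + _]US qU//; lra.
rewrite U0; apply/cvgrPdist_lt => e e0.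
have [||N VN] := @upper_probability_cvg0 U e mU _ _ e0.
- move=> n m nm w [i /= mi Fi]; exists i => //=; exact: leq_trans mi.
- rewrite -subset0 => w Uw; have [i _ Fi] := Uw 0%N I.
  have [j /= ij Fj] := Uw i.+1 I.
  have := tF i j I I (ex_intro _ w (conj Fi Fj)).
  by move=> eij; rewrite eij ltnn in ij.
exists N => // n /= Nn; rewrite qU0 opprB addrCA subrr addr0 ger0_norm ?q_ge0//.
rewrite (le_lt_trans (q_le (mU n)))// (le_lt_trans _ VN)//.
apply: upper_probability_le => // w [i /= mi Fi]; exists i => //=.
exact: leq_trans mi.
Qed.

Lemma dominated_content_probability :
  exists Q : probability T R, forall A, measurable A -> Q A = (q A)%:E.
Proof.
(* The value 0 off the measurable sets makes [m] nonnegative on every set, whereas [q] is controlled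
   only on measurable ones. *)
pose m (A : set T) : \bar R := if `[< measurable A >] then (q A)%:E else 0%E.
have mE A : measurable A -> m A = (q A)%:E.
  by move=> mA; rewrite /m; case: asboolP.
have q0 : q set0 = 0.
  by have := qU measurable0 measurable0 (setI0 _); rewrite setU0; lra.
have m0 : m set0 = 0%E by rewrite mE// q0.
have m_ge0 A : (0 <= m A)%E.
  by rewrite /m; case: asboolP => // mA; rewrite lee_fin q_ge0.
have m_add : semi_sigma_additive m.
  move=> F mF tF mUF; rewrite mE//.
  under eq_fun do (under eq_bigr do rewrite mE//; rewrite sumEFin).
  apply: cvg_EFin; first exact: nearW.
  exact: dominated_content_sigma_additive.
pose mM := isMeasure.Build _ _ _ m m0 m_ge0 m_add.
pose M : {measure set T -> \bar R} := HB.pack m mM.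
have M1 : M setT = 1%E by rewrite /= mE// q_setT.
pose mP := Measure_isProbability.Build _ _ _ M M1.
pose Q : probability T R := HB.pack m mM mP.
by exists Q.
Qed.

End dominated_content.

End upper_probability.

(** * Invariant upper probabilities and the measures in their core *)

Section upper_probability_dynamics.
Context (d : measure_display) (T : measurableType d) (R : realType).
Context (tr : T -> T) (V : set T -> R).
Hypothesis mtr : measurable_fun setT tr.
Hypothesis upV : upper_probability V.

Lemma measurable_preimage_iter A n :
  measurable A -> measurable (iter n tr @^-1` A).
Proof.
move=> mA; rewrite -[X in measurable X]setTI.
exact: (measurable_iter mtr n measurableT mA).
Qed.

Lemma cap_invariant_iter A n : cap_invariant tr V -> measurable A ->
  V (iter n tr @^-1` A) = V A.
Proof.
move=> invV mA; elim: n => // n <-.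
rewrite -[RHS]invV; last exact: measurable_preimage_iter.
by congr V; apply/seteqP; split=> w /=; rewrite -iterS iterSr.
Qed.

(* The measure is a limit, along an ultrafilter, of the Cesaro means of the
   images under [tr] of an element of the generating set. *)
Lemma exists_invariant_in_core : cap_invariant tr V ->
  exists Q : probability T R,
    (forall A, measurable A -> Q (tr @^-1` A) = Q A) /\ in_core V Q.
Proof.
move=> invV; have [_ [L [_ LV]]] := upV.
have [[P LP _] _] := LV _ measurableT.
have P_le A : measurable A -> fine (P A) <= V A.
  by move=> mA; have [_] := LV _ mA; exact.
(* A single ultrafilter serves all sets [A] at once, so the limits stay additive in [A]. *)
have [U [UU ooU]] := ultraFilterLemma eventually_filter.
have PU : ProperFilter U by exact: ultra_proper.
pose avg A n : R := n%:R^-1 * \sum_(i < n) fine (P (iter i tr @^-1` A)).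
have avg_ge0 A n : 0 <= avg A n.
  by apply: mulr_ge0; rewrite ?invr_ge0// sumr_ge0// => i _; exact: fine_ge0.
have avg_le A n : measurable A -> avg A n <= V A.
  move=> mA; case: n => [|n].
    by rewrite /avg big_ord0 mulr0 upper_probability_ge0.
  rewrite /avg ler_pdivrMl// mulr_natl.
  have -> : V A *+ n.+1 = \sum_(i < n.+1) V A by rewrite sumr_const card_ord.
  apply: ler_sum => i _; rewrite -(cap_invariant_iter i invV mA).
  exact/P_le/measurable_preimage_iter.
have avg_cvg A : measurable A -> cvg (avg A @ U).
  move=> mA; apply: (@ultra_bounded_cvg _ _ U UU _ 0 (V A)) => n.
  by rewrite avg_ge0 avg_le.
pose q A : R := lim (avg A @ U).
have q_cvg A : measurable A -> avg A @ U --> q A by exact: avg_cvg.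
have q_ge0 A : measurable A -> 0 <= q A.
  by move=> mA; apply: limr_ge; [exact: avg_cvg|exact: nearW].
have q_le A : measurable A -> q A <= V A.
  move=> mA; apply: limr_le; [exact: avg_cvg|apply: nearW => n].
  exact: avg_le.
have q_setT : q setT = 1.
  apply: (cvg_lim (@Rhausdorff _)); apply: cvg_near_cst; apply: ooU.
  exists 1%N => // -[//|n] _; rewrite /= /avg.
  under eq_bigr do rewrite preimage_setT probability_setT.
  by rewrite sumr_const card_ord mulVf.
have qU A B : measurable A -> measurable B -> A `&` B = set0 ->
    q (A `|` B) = q A + q B.
  move=> mA mB AB0; apply: (cvg_lim (@Rhausdorff _)).
  rewrite (_ : avg _ = avg A \+ avg B); first by apply: cvgD; exact: q_cvg.
  apply/funext => n; rewrite /avg /= -mulrDr -big_split/=; congr (_ * _).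
  apply: eq_bigr => i _; rewrite preimage_setU measureU.
  - by rewrite fineD// fin_num_measure//; exact: measurable_preimage_iter.
  - exact: measurable_preimage_iter.
  - exact: measurable_preimage_iter.
  - by rewrite -preimage_setI AB0 preimage_set0.
have q_tr A : measurable A -> q (tr @^-1` A) = q A.
  move=> mA; have mtA := measurable_preimage_iter 1 mA.
  apply: (cvg_lim (@Rhausdorff _)).
  rewrite (_ : avg _ = avg A \+ (avg (tr @^-1` A) \- avg A)); last first.
    by apply/funext => n /=; rewrite addrC subrK.
  rewrite -[X in _ --> X]addr0; apply: cvgD; first exact: q_cvg.
  (* [U] refines [\oo], so convergence along [\oo] suffices. The sums of [n.+1] terms differ only by
     their end terms, which lie in [[0, 1]], so the averages differ by at most [n.+1%:R^-1]. *)
  suff : (avg (tr @^-1` A) \- avg A) @ \oo --> (0 : R).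
    by move=> h; apply: cvg_trans h; exact: cvg_app.
  apply/cvgrPdist_lt => e e0.
  have : (n.+1%:R^-1 : R) @[n --> \oo] --> 0 by exact: cvg_harmonic.
  move=> /cvgrPdist_lt /(_ _ e0)[N _ Ne].
  exists N.+1 => // -[//|n] /= Nn; rewrite sub0r normrN.
  have := Ne n Nn; rewrite sub0r normrN; apply: le_lt_trans.
  have PA i : 0 <= fine (P (iter i tr @^-1` A)) <= 1.
    rewrite fine_ge0//= -lee_fin fineK; last first.
      by rewrite fin_num_measure//; exact: measurable_preimage_iter.
    by apply: probability_le1; exact: measurable_preimage_iter.
  rewrite /avg -mulrBr normrM [X in _ <= X]ger0_norm// ger0_norm//.
  rewrite ler_piMr// big_ord_recr/= [X in `|_ - X|]big_ord_recl.
  set S := \sum_(i < n) _.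
  have := PA 0%N; have := PA n.+1; rewrite /= => ? ?.
  by rewrite ler_norml; apply/andP; split; lra.
have [Q QE] := dominated_content_probability upV q_ge0 q_setT qU q_le.
exists Q; split=> A mA; last by rewrite QE//= q_le.
by rewrite !QE ?q_tr//; exact: (measurable_preimage_iter 1 mA).
Qed.

(** * From an invariant probability in the core to [V]-a.s. limits *)

Section invariant_in_core.
Context (Q : probability T R).
Hypothesis ergV : cap_ergodic tr V.
Hypothesis coreQ : in_core V Q.
Hypothesis invQ : forall A, measurable A -> Q (tr @^-1` A) = Q A.

Lemma in_core_null A : measurable A -> V A = 0 -> Q A = 0%E.
Proof.
move=> mA VA; apply/eqP; rewrite eq_le measure_ge0 andbT.
by have := coreQ mA; rewrite VA -lee_fin fineK ?fin_num_measure.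
Qed.

Lemma in_core_ergodic : ergodic_prob tr Q.
Proof.
split=> // A [mA trA]; have [_ VA] := ergV.
have [_ [VA0|VCA0]] := VA A (conj mA trA); first by left; exact: in_core_null.
right; rewrite -[A]setCK probability_setC ?in_core_null ?sube0//;
  exact: measurableC.
Qed.

(** Here a statement about [Q] becomes one about [V]: by ergodicity of [V], the only alternative is
    a [V]-null, hence [Q]-null, complement, which would make the integral nonnegative. *)
Lemma cap_unbounded_sums0 (g : T -> R) : Q.-integrable setT (EFin \o g) ->
  (\int[Q]_x (g x)%:E < 0)%E -> V (unbounded_sums tr g) = 0.
Proof.
move=> ig g0; have mg : measurable_fun setT g.
  by move/integrableP : ig => [/measurable_EFinP].
have [mU trU] := unbounded_sums_invariant mtr mg.
have [_ VU] := ergV.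
have [_ [//|VC0]] := VU _ (conj mU trU).
have := integral_ge0_unbounded_sums mtr invQ ig
  (in_core_null (measurableC mU) VC0).
by rewrite leNgt g0.
Qed.

(** If [K] bounds the sums of [f - a], the averages of [f] are at most [a + K / n], which is below
    [b] for large [n]. *)
Lemma birkhoff_avg_lt (f : T -> R) (a b : R) w : a < b ->
  ~ unbounded_sums tr (fun x => f x - a) w ->
  \forall n \near \oo, birkhoff_avg tr f w n < b.
Proof.
move=> ab /existsNP[K /forallNP SK].
have {}SK n : birkhoff_sum tr f w n <= n%:R * a + K.
  have /negP := SK n; rewrite -leNgt /birkhoff_sum big_split/= sumr_const.
  by rewrite card_ord mulNrn lerBlDl mulr_natl.
exists (Num.bound (`|K| / (b - a))).+1 => // n /= Kn.
have n0 : (0 < n)%N by exact: leq_ltn_trans Kn.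
have n0R : 0 < n%:R :> R by rewrite ltr0n.
have ba : 0 < b - a by rewrite subr_gt0.
rewrite /birkhoff_avg ltr_pdivrMl// (le_lt_trans (SK n))//.
rewrite -ltrBrDl -mulrBr (le_lt_trans (ler_norm _))// -ltr_pdivrMr//.
have K0 : 0 <= `|K| / (b - a) by rewrite divr_ge0// ltW.
by rewrite (lt_le_trans (archi_boundP K0))// ler_nat ltnW.
Qed.

Lemma cap_birkhoff_avg_lt (f : T -> R) : Q.-integrable setT (EFin \o f) ->
  cap_as V (fun w => forall b, fine (\int[Q]_x (f x)%:E) < b ->
    \forall n \near \oo, birkhoff_avg tr f w n < b).
Proof.
move=> intf; set c := fine _.
have intfE : (\int[Q]_x (f x)%:E = c%:E)%E.
  by rewrite /c fineK//; exact: integrable_fin_num.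
(* Countably many thresholds decreasing to [c] suffice, so one [V]-null set serves every [b > c]. *)
pose g k x := f x - (c + k.+1%:R^-1).
have ig k : Q.-integrable setT (EFin \o g k).
  exact: (integrableB measurableT intf
    (finite_measure_integrable_cst Q (c + k.+1%:R^-1) measurableT)).
have mU k : measurable (unbounded_sums tr (g k)).
  apply: (unbounded_sums_invariant mtr _).1.
  by apply/measurable_EFinP; move/integrableP : (ig k) => [].
have VU k : V (unbounded_sums tr (g k)) = 0.
  apply: cap_unbounded_sums0 => //; rewrite /g.
  under eq_integral do rewrite EFinB.
  rewrite integralB_EFin//; last exact: finite_measure_integrable_cst.
  rewrite intfE (integral_cst Q measurableT).
  rewrite [X in (_ * X)%E](_ : _ = 1%E); last exact: probability_setT.
  rewrite mule1 -EFinB lte_fin.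
  by rewrite opprD addrA subrr sub0r oppr_lt0 invr_gt0.
exists (~` \bigcup_k unbounded_sums tr (g k)); split.
- by apply: measurableC; exact: bigcup_measurable.
- by rewrite setCK; exact: upper_probability_bigcup0.
move=> w Uw b cb; have bc : 0 < b - c by rewrite subr_gt0.
have [k kb] : exists k, k.+1%:R^-1 < b - c.
  have /cvgrPdist_lt/(_ _ bc)[k _ /(_ k (leqnn k))] := @cvg_harmonic R.
  by rewrite sub0r normrN ger0_norm ?harmonic_ge0 => // ?; exists k.
apply: (@birkhoff_avg_lt _ (c + k.+1%:R^-1)); first by rewrite -ltrBrDl.
by move=> Uk; apply: Uw; exists k.
Qed.

Lemma in_core_limit_property : limit_property tr V Q.
Proof.
move=> f intf; have intNf : Q.-integrable setT (EFin \o (fun x => - f x)).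
  exact: (integrableN intf).
have [A [mA VA fA]] := cap_birkhoff_avg_lt intf.
have [B [mB VB fB]] := cap_birkhoff_avg_lt intNf.
exists (A `&` B); split; first exact: measurableI.
  (* The union of two null sets is treated as a countable one, padded with [set0]. *)
  rewrite setCI -bigcup2E; apply: upper_probability_bigcup0 => //.
    by move=> [|[|n]] //=; exact: measurableC.
  by move=> [|[|n]] //=; exact: upper_probability_set0.
move=> w [Aw Bw]; apply/cvgrPdist_lt => e e0.
have f1 : \forall n \near \oo, birkhoff_avg tr f w n <
    fine (\int[Q]_x (f x)%:E) + e by apply: fA => //; rewrite ltrDl.
have f2 : \forall n \near \oo, birkhoff_avg tr (fun x => - f x) w n <
    - fine (\int[Q]_x (f x)%:E) + e.
  apply: fB => //; under eq_integral do rewrite EFinN.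
  rewrite integralN; last exact: integrable_add_def.
  by rewrite fineN ltrDl.
near=> n; rewrite ltr_distlC; apply/andP; split; last by near: n.
rewrite -ltrN2 opprB addrC.
have -> : - birkhoff_avg tr f w n = birkhoff_avg tr (fun x => - f x) w n.
  by rewrite /birkhoff_avg sumrN mulrN.
by near: n.
Unshelve. all: by end_near.
Qed.

End invariant_in_core.

(** The two convergence sets for the indicator of [A] have [V]-null complements, so they meet, since
    [V setT = 1]. At a common point the limit is both [Q A] and [Q' A]. *)
Lemma limit_property_unique (Q Q' : probability T R) :
  limit_property tr V Q -> limit_property tr V Q' ->
  forall A, measurable A -> Q' A = Q A.
Proof.
move=> limQ limQ' A mA.
have int1 (P : probability T R) : P.-integrable setT (EFin \o \1_A).
  exact: (integrable_indic P mA).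
have [B [mB VB lB]] := limQ _ (int1 Q).
have [C [mC VC lC]] := limQ' _ (int1 Q').
have [w [Bw Cw]] : B `&` C !=set0.
  apply/set0P/negP => /eqP BC0.
  have VU : V (~` B `|` ~` C) = 0.
    rewrite -bigcup2E; apply: upper_probability_bigcup0 => //.
      by move=> [|[|n]] //=; exact: measurableC.
    by move=> [|[|n]] //=; exact: upper_probability_set0.
  move: VU; rewrite -setCI BC0 setC0 (upper_probability_setT upV).
  by move/eqP; rewrite oner_eq0.
have := cvg_unique (@Rhausdorff _) (lC w Cw) (lB w Bw).
rewrite !integral_indic// !setIT => QQ'.
by rewrite -[LHS]fineK ?fin_num_measure// QQ' fineK ?fin_num_measure.
Qed.

(** The indicator of an invariant [B] is constant along orbits, so it equals [Q B] off a [V]-null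
    set. As [Q B] is 0 or 1, either [B] or its complement lies in that null set. *)
Lemma limit_property_cap_ergodic (Q : probability T R) :
  cap_invariant tr V -> ergodic_prob tr Q -> in_core V Q ->
  limit_property tr V Q -> cap_ergodic tr V.
Proof.
move=> invV [_ ergQ] coreQ limQ; split=> // B [mB trB].
have iB i w : iter i tr w \in B = (w \in B).
  elim: i => //= i <-; apply/idP/idP; rewrite !inE => h.
    by rewrite -trB.
  by rewrite -trB in h.
have [A [mA VA lA]] := limQ _ (integrable_indic Q mB).
have {}lA w : A w -> (\1_B w)%:E = Q B.
  move=> Aw; have := lA w Aw; rewrite integral_indic// setIT => lw.
  rewrite -[RHS]fineK ?fin_num_measure//; congr EFin.
  apply: (cvg_unique (@Rhausdorff _) _ lw); apply: cvg_near_cst.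
  (* The average over 0 terms is 0 by convention, so constancy starts at 1. *)
  exists 1%N => // -[//|n] _; rewrite /birkhoff_avg.
  under eq_bigr do rewrite indicE iB.
  by rewrite sumr_const card_ord -[X in _ * X]mulr_natl mulKf// indicE.
have null C : measurable C -> C `<=` ~` A -> V C = 0.
  move=> mC CA; apply/eqP; rewrite eq_le upper_probability_ge0// andbT -VA.
  by apply: upper_probability_le => //; exact: measurableC.
have [QB|QB] := ergQ B (conj mB trB).
  have VB : V B = 0.
    apply: null => // w Bw Aw; have := lA w Aw.
    by rewrite QB indicE mem_set// => /eqP; rewrite eqe oner_eq0.
  by rewrite VB; split; left.
split; right.
  (* [V B = 1] because [1 = Q B <= V B <= V setT = 1]. *)
  apply/eqP; rewrite eq_le -{1}(upper_probability_setT upV).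
  rewrite upper_probability_le//=.
  by have := coreQ _ mB; rewrite QB.
apply: null; first exact: measurableC.
move=> w Bw Aw; have := lA w Aw.
by rewrite QB indicE memNset// => /eqP; rewrite eqe eq_sym oner_eq0.
Qed.

End upper_probability_dynamics.

Theorem theorem3p3 (d : measure_display) (T : measurableType d) (R : realType)
  (tr : T -> T) (V : set T -> R) :
  measurable_fun setT tr ->
  upper_probability V ->
  cap_invariant tr V ->
  (cap_ergodic tr V <->
   exists Q : probability T R,
     [/\ ergodic_prob tr Q, in_core V Q, limit_property tr V Q &
         forall Q' : probability T R,
           ergodic_prob tr Q' -> in_core V Q' -> limit_property tr V Q' ->
           forall A, measurable A -> Q' A = Q A]).
Proof.
move=> mtr upV invV; split=> [ergV|[Q [ergQ coreQ limQ _]]].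
  have [Q [invQ coreQ]] := exists_invariant_in_core mtr upV invV.
  have limQ := in_core_limit_property mtr upV ergV coreQ invQ.
  exists Q; split=> //; first exact: in_core_ergodic coreQ invQ.
  by move=> Q' _ _; exact: limit_property_unique.
exact: limit_property_cap_ergodic limQ.
Qed.
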